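(* Let $y=y(N)\ge 2$ be a real-valued function of the integer $N\ge 2$ satisfying $y(N)=o(\log N)$ as $N\to\infty$. Then, as $N\to\infty$, uniformly for integers $k\geq 1$, $$M_k(N,y)\sim \Psi(N^k,y);$$ that is, $\sup_{k\ge 1}\left|\frac{M_k(N,y(N))}{\Psi(N^k,y(N))}-1\right|\to 0$ as $N\to\infty$.
   Context: $P^{+}(n)$ denotes the largest prime factor of the positive integer $n$, with $P^{+}(1):=1$. Write $[N]:=\{1,\ldots,N\}$. For integers $N\ge 2$, $k\geq 1$ and real $y$, $$M_k(N,y):=\#\{x_1\cdots x_k : x_i\in[N],\ P^{+}(x_i)\leq y\text{ for all } i\}$$ is the number of distinct products of $k$ $y$-smooth integers from $[N]$. Also $\Psi(x,y):=\#\{n\leq x : P^{+}(n)\leq y\}$, where $n$ ranges over positive integers. *)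

(* Defs.v *)
From mathcomp Require Import all_boot all_order all_algebra.
From mathcomp Require Import finmap.
From mathcomp Require Import reals.

Set Implicit Arguments.
Unset Strict Implicit.
Unset Printing Implicit Defensive.

Import Order.TTheory GRing.Theory Num.Theory.

Local Open Scope ring_scope.

(* [max_pdiv 1 = 1], which is the convention P^+(1) := 1. *)
Definition smooth (R : realType) (y : R) (n : nat) : bool :=
  (max_pdiv n)%:R <= y.

(* For [0 <= x], the naturals [n] with [n%:R <= x] are those with
   [(n <= Num.truncn x)%N]; for [x < 0], [Num.truncn x = 0%N] and the count
   is zero. *)
Definition Psi (R : realType) (x y : R) : nat :=
  #|[pred n : 'I_(Num.truncn x).+1 | (0 < n)%N && smooth y n]|.

(* [x i] ranges over ['I_N.+1], so [x i] lies in {1, ..., N} iff it is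
   positive. *)
Definition M (R : realType) (k N : nat) (y : R) : nat :=
  #|` [fset (\prod_(i < k) x i)%N
       | x : {ffun 'I_k -> 'I_N.+1}
         in [pred x : {ffun 'I_k -> 'I_N.+1} |
             [forall i, (0 < x i)%N && smooth y (x i)]]]%fset |.

(* Main.v *)
(** Put [z = floor y], [x = N ^ k], and let [A t] and [O t] count the [z]-smooth,
respectively odd [z]-smooth, integers up to [t]. Greedily splitting off the
largest divisor that is at most [N] shows that every [z]-smooth [n] with
[n * z ^ k <= N ^ k] is a product of [k] smooth integers of [[N]], so at most
[A x - A (x / z ^ k)] smooth integers are missed. Since [A t - A (t / 2) <= O t]
and [O] is monotone, this is at most [k (log2 z + 1) O x].

To bound [O x], take an odd smooth [n <= x] and trade a power [q ^ j] dividing it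
for a power [2 ^ b <= q ^ j], or multiply it by [2 ^ b <= x / n]. The result is
smooth and at most [x], and it determines [n] and [b] once [q] is known, while an
[n] admits at least about [log2 x / 2] such moves. Hence
[k log2 N * O x <= 2 pi(z) A x]. Chebyshev's bound [pi(z) log z = O(z)] then
shows that the missed proportion is [O(y / log N)], uniformly in [k]. *)

Require Import Defs.
From mathcomp Require Import all_boot all_order all_algebra.
From mathcomp Require Import finmap.
From mathcomp Require Import all_classical all_reals all_analysis.
From mathcomp Require Import zify.

Import Order.TTheory GRing.Theory Num.Theory.
Import numFieldNormedType.Exports.

Set Implicit Arguments.
Unset Strict Implicit.

(** * Smooth integers and primes up to a bound *)

Definition primes_upto (n : nat) : seq nat := [seq p <- iota 1 n | prime p].

Definition smooths (z x : nat) : seq nat := [seq n <- iota 1 x | max_pdiv n <= z].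

Definition odd_smooths (z x : nat) : seq nat := [seq n <- smooths z x | odd n].

Lemma mem_primes_upto p n : (p \in primes_upto n) = prime p && (p <= n).
Proof.
rewrite mem_filter mem_iota add1n ltnS; case: (boolP (prime p)) => //= /prime_gt0 ->.
by [].
Qed.

Lemma primes_upto_uniq n : uniq (primes_upto n).
Proof. exact: filter_uniq (iota_uniq _ _). Qed.

Lemma max_pdiv_leP z n : 0 < z -> 0 < n ->
  reflect (forall p, prime p -> p %| n -> p <= z) (max_pdiv n <= z).
Proof.
move=> z0 n0; apply: (iffP idP) => [le p pp pn|H].
  by apply: leq_trans le; apply: max_pdiv_max; rewrite mem_primes pp n0.
case: (ltngtP n 1) => n1; [by lia| |by rewrite n1].
by apply: H; [apply: max_pdiv_prime|apply: max_pdiv_dvd].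
Qed.

Lemma mem_smooths z x n :
  (n \in smooths z x) = [&& 0 < n, n <= x & max_pdiv n <= z].
Proof. by rewrite mem_filter mem_iota add1n ltnS andbC andbA. Qed.

Lemma smooths_uniq z x : uniq (smooths z x).
Proof. exact: filter_uniq (iota_uniq _ _). Qed.

Lemma max_pdiv_dvd_le z m n : 0 < z -> 0 < n -> m %| n ->
  max_pdiv n <= z -> max_pdiv m <= z.
Proof.
move=> z0 n0 mn /(max_pdiv_leP z0 n0) H.
apply/max_pdiv_leP => // [|p pp pm]; first exact: dvdn_gt0 mn.
exact: H pp (dvdn_trans pm mn).
Qed.

Lemma max_pdiv_mul_le z m n : 0 < z -> 0 < m -> 0 < n ->
  max_pdiv m <= z -> max_pdiv n <= z -> max_pdiv (m * n) <= z.
Proof.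
move=> z0 m0 n0 /(max_pdiv_leP z0 m0) Hm /(max_pdiv_leP z0 n0) Hn.
apply/max_pdiv_leP => // [|p pp]; first by rewrite muln_gt0 m0.
by rewrite Euclid_dvdM // => /orP[]; [apply: Hm|apply: Hn].
Qed.

(** * Odd smooth integers are a small share of all smooth integers *)

Lemma max_pdiv_pow2_le z b : 1 < z -> max_pdiv (2 ^ b) <= z.
Proof.
move=> z1; apply/max_pdiv_leP => [||p pp]; [by lia|by rewrite expn_gt0|].
by rewrite Euclid_dvdX // => /andP[/dvdn_leq-/(_ isT)/leq_trans->].
Qed.

(* The exponent [b] is recovered as the 2-adic valuation of
   [2 ^ b * (n %/ g b)], whence [g b] and [n]. *)
Lemma odd_smooths_sum_le z x (s g : nat -> nat) : 1 < z ->
    (forall n b, n \in odd_smooths z x -> b < s n ->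
       g b %| n /\ 2 ^ b * (n %/ g b) <= x) ->
  \sum_(n <- odd_smooths z x) s n <= size (smooths z x).
Proof.
move=> z1 H.
pose L := [seq 2 ^ b * (n %/ g b) | n <- odd_smooths z x, b <- iota 0 (s n)].
have -> : \sum_(n <- odd_smooths z x) s n = size L.
  rewrite size_allpairs_dep sumnE big_map.
  by apply: eq_bigr => n _; rewrite size_iota.
have odds n : n \in odd_smooths z x -> odd n /\ n \in smooths z x.
  by rewrite mem_filter => /andP.
have dvd_odd n b : n \in odd_smooths z x -> b < s n -> odd (n %/ g b).
  move=> nO bs; have [gn _] := H _ _ nO bs; have [on _] := odds _ nO.
  by apply: dvdn_odd on; apply: dvdn_div.
apply: uniq_leq_size.
  apply: allpairs_uniq_dep => [|n _|[n b] [n' b']].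
  - exact/filter_uniq/smooths_uniq.
  - exact: iota_uniq.
  move=> /allpairsPdep[n1 [b1 [nO b_s]]] [E1 E2].
  move=> /allpairsPdep[n2 [b2 [nO' b_s']]] [E3 E4].
  subst; rewrite !mem_iota !add0n /= in b_s b_s' *.
  move=> E; have [gn _] := H _ _ nO b_s; have [gn' _] := H _ _ nO' b_s'.
  have := congr1 (logn 2) E.
  have lo n b : n \in odd_smooths z x -> b < s n ->
      logn 2 (2 ^ b * (n %/ g b)) = b.
    move=> nOd bs; have o := dvd_odd _ _ nOd bs.
    rewrite lognM ?expn_gt0 ?(odd_gt0 o) // pfactorK // lognE.
    by rewrite dvdn2 o /= andbF addn0.
  rewrite !lo // => Eb; rewrite Eb in E gn *.
  move/eqP: E; rewrite eqn_pmul2l ?expn_gt0 // => /eqP E.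
  by rewrite -(divnK gn) E divnK.
move=> _ /allpairsPdep[n [b [nO bs ->]]]; rewrite mem_iota /= add0n in bs.
have [gn le] := H _ _ nO bs; have [on] := odds _ nO.
rewrite !mem_smooths => /and3P[n0 nx nz]; rewrite le muln_gt0 expn_gt0 /=.
rewrite odd_gt0 ?dvd_odd //=; apply: max_pdiv_mul_le; rewrite ?expn_gt0 //.
- by lia.
- by rewrite odd_gt0 ?dvd_odd.
- exact: max_pdiv_pow2_le.
by apply: max_pdiv_dvd_le nz => //; [lia|apply: dvdn_div].
Qed.

(** The divisor [g b] is the least power of [q] that is at least [2 ^ b]. It divides [n] as soon as
    [2 ^ b <= q ^ logn q n], and exchanging it for [2 ^ b] cannot increase [n]. *)
Lemma sum_trunc_log_pfactor_le z x q : 1 < z -> prime q ->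
  \sum_(n <- odd_smooths z x) trunc_log 2 (q ^ logn q n) <= size (smooths z x).
Proof.
move=> z1 pq; have q1 := prime_gt1 pq.
apply: (@odd_smooths_sum_le _ _ _ (fun b => q ^ up_log q (2 ^ b))) => // n b.
rewrite mem_filter mem_smooths => /andP[on /and3P[n0 nx nz]] bs.
have gn : q ^ up_log q (2 ^ b) %| n.
  rewrite pfactor_dvdn //; apply: up_log_min => //.
  have : 2 ^ b <= 2 ^ trunc_log 2 (q ^ logn q n) by rewrite leq_exp2l // ltnW.
  by move=> /leq_trans; apply; apply: trunc_logP => //; rewrite expn_gt0; lia.
split=> //; apply: leq_trans nx; rewrite -[leqRHS](divnK gn) mulnC leq_mul2l.
by rewrite up_logP ?orbT.
Qed.

(** Nothing is divided out here: [n] is multiplied by each [2 ^ b <= x %/ n]. The exponent [b = 0]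
    accounts for the successor. *)
Lemma sum_trunc_log_div_le z x : 1 < z ->
  \sum_(n <- odd_smooths z x) (trunc_log 2 (x %/ n)).+1 <= size (smooths z x).
Proof.
move=> z1; apply: (@odd_smooths_sum_le _ _ _ (fun=> 1)) => // n b.
rewrite mem_filter mem_smooths => /andP[on /and3P[n0 nx nz]].
rewrite ltnS divn1 dvd1n => bs; split=> //.
rewrite -leq_divRL //.
have : 2 ^ b <= 2 ^ trunc_log 2 (x %/ n) by rewrite leq_exp2l.
by move/leq_trans; apply; apply: trunc_logP => //; rewrite divn_gt0.
Qed.

Lemma prod_pfactor_primes_upto z n : 0 < z -> 0 < n -> max_pdiv n <= z ->
  n = \prod_(p <- primes_upto z) p ^ logn p n.
Proof.
move=> z0 n0 /(max_pdiv_leP z0 n0) H.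
rewrite {1}[n]prod_prime_decomp // prime_decompE big_map /=.
rewrite [RHS](bigID (fun p => p %| n)) /= [X in _ * X]big1 ?muln1; last first.
  by move=> p pn; rewrite lognE (negPf pn) !andbF.
rewrite -[RHS]big_filter; apply: perm_big; apply: uniq_perm => [||p].
- exact: primes_uniq.
- exact/filter_uniq/primes_upto_uniq.
rewrite mem_primes mem_filter mem_primes_upto n0.
by case: (boolP (prime p)) => //= pp; case: (boolP (p %| n)) => //= /(H _ pp) ->.
Qed.

(** This guarantees that each [n] admits enough moves. A prime power above 1 has floor logarithm
    [l >= 1], hence is below [2 ^ l.+1 <= 2 ^ (2 * l)]; multiplying these gives [n <= 2 ^ (2 * s)].
    Combined with [x < n * 2 ^ u.+1], this bounds [t]. *)
Lemma log_le_sum_trunc_log z x t n : 0 < z -> n \in odd_smooths z x ->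
    2 ^ t <= x ->
  t <= 2 * \sum_(p <- primes_upto z | odd p) trunc_log 2 (p ^ logn p n)
       + trunc_log 2 (x %/ n).
Proof.
move=> z0; rewrite mem_filter mem_smooths => /andP[on /and3P[n0 nx nz]] tx.
set s := \sum_(p <- _ | _) _; set u := trunc_log _ _.
rewrite -ltnS -(@ltn_exp2l 2) //.
have ns : n <= 2 ^ (2 * s).
  have En : n = \prod_(p <- primes_upto z | odd p) p ^ logn p n.
    rewrite [LHS](prod_pfactor_primes_upto z0 n0 nz) [RHS]big_mkcond.
    apply: eq_bigr => p _; case: ifPn => // op; rewrite lognE.
    by case: ifP => // /and3P[_ _ /dvdn_odd/(_ on)]; rewrite (negPf op).
  rewrite [leqLHS]En /s big_distrr /= expn_sum big_seq_cond [leqRHS]big_seq_cond.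
  elim/big_ind2: _ => // [a b c d|p]; first exact: leq_mul.
  rewrite mem_primes_upto => /andP[/andP[pp _] _].
  have [->|l0] := posnP (logn p n); first by rewrite expn0 expn_gt0.
  have pl : 1 < p ^ logn p n by rewrite -(expn0 p) ltn_exp2l // prime_gt1.
  apply: leq_trans (ltnW (trunc_log_ltn _ (isT : 1 < 2))) _.
  by rewrite leq_exp2l // mul2n -addnn -[X in X < _]addn0 ltn_add2l trunc_log_gt0.
apply: leq_ltn_trans tx _.
have : x < n * 2 ^ u.+1.
  by rewrite mulnC -ltn_divLR // trunc_log_ltn.
move=> /leq_trans; apply; rewrite -addnS expnD leq_mul2r.
by rewrite ns orbT.
Qed.

(** Double counting: [log_le_sum_trunc_log] is summed over [n] and the sums are exchanged, so that
    each odd prime costs at most [2 * A]. *)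
Lemma mul_size_odd_smooths_le z x t : 1 < z -> 2 ^ t <= x ->
  t * size (odd_smooths z x) <= 2 * size (primes_upto z) * size (smooths z x).
Proof.
move=> z1 tx; have z0 : 0 < z by lia.
rewrite -sum1_size big_distrr /= big_seq_cond.
set A := size (smooths z x).
apply: leq_trans (leq_sum _ _) _ => [n|].
  rewrite andbT => nO; rewrite muln1; exact: log_le_sum_trunc_log nO tx.
rewrite -big_seq_cond big_split /= -big_distrr /= exchange_big /=.
(* The prime 2 is set aside: its share of the bound pays for the terms [trunc_log 2 (x %/ n)], which
   cost at most [A] in total. *)
have -> : size (primes_upto z) = (size [seq p <- primes_upto z | odd p]).+1.
  have : count (predC odd) (primes_upto z) = 1.
    have -> : count (predC odd) (primes_upto z) = count_mem 2 (primes_upto z).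
      apply: eq_in_count => p; rewrite mem_primes_upto => /andP[pp _] /=.
      by case: (even_prime pp) => [->//|op]; rewrite op; case: eqP op => // ->.
    by rewrite count_uniq_mem ?primes_upto_uniq // mem_primes_upto z1.
  by rewrite -(count_predC odd) size_filter => ->; rewrite addn1.
have h1 : \sum_(p <- primes_upto z | odd p)
    \sum_(n <- odd_smooths z x) trunc_log 2 (p ^ logn p n)
    <= size [seq p <- primes_upto z | odd p] * A.
  rewrite -sum1_size big_distrl /= big_filter big_seq_cond [leqRHS]big_seq_cond.
  apply: leq_sum => p; rewrite mem_primes_upto => /andP[/andP[pp _] _].
  by rewrite mul1n sum_trunc_log_pfactor_le.
have h2 : \sum_(n <- odd_smooths z x) trunc_log 2 (x %/ n) <= A.
  by apply: leq_trans (sum_trunc_log_div_le x z1); apply: leq_sum.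
by lia.
Qed.

(** * Halving the range, and greedy factorization *)

Lemma size_odd_smooths_mono z x x' : x <= x' ->
  size (odd_smooths z x) <= size (odd_smooths z x').
Proof.
move=> xx; apply: uniq_leq_size => [|n]; first exact/filter_uniq/smooths_uniq.
rewrite !mem_filter !mem_iota => /and4P[-> -> -> /= h].
by apply: leq_trans h _; rewrite leq_add2l.
Qed.

(** An even smooth integer is the double of a smooth integer up to [x %/ 2]. *)
Lemma size_smooths_half z x : 0 < z ->
  size (smooths z x) <= size (smooths z (x %/ 2)) + size (odd_smooths z x).
Proof.
move=> z0; rewrite addnC -(size_map double (smooths _ (x %/ 2))) -size_cat.
apply: uniq_leq_size => [|n nS]; first exact: smooths_uniq.
rewrite mem_cat mem_filter nS andbT; case: (boolP (odd n)) => //= on.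
have En : n = (n./2).*2 by rewrite even_halfK.
apply/mapP; exists n./2 => //; move: nS; rewrite !mem_smooths => /and3P[n0 nx nz].
rewrite divn2 half_leq // andTb; apply/andP; split; first by lia.
apply: max_pdiv_dvd_le nz => //; rewrite {2}En -muln2; exact: dvdn_mulr.
Qed.

Lemma size_smooths_div_pow2 z x m : 0 < z ->
  size (smooths z x) <= size (smooths z (x %/ 2 ^ m)) + m * size (odd_smooths z x).
Proof.
move=> z0; elim: m => [|m IH]; first by rewrite divn1 addn0.
apply: leq_trans IH _; rewrite expnSr divnMA.
have := size_smooths_half (x %/ 2 ^ m) z0.
have := size_odd_smooths_mono z (leq_div x (2 ^ m)).
by lia.
Qed.

(** Induction on [k], splitting off the largest divisor [d <= N]. If a prime [p] divides [n %/ d],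
    then [d * p] divides [n] and so exceeds [N] by maximality. Hence [N < d * z], and the hypothesis
    passes to [n %/ d] with one factor fewer. *)
Lemma smooth_factorization z N k n : 0 < z -> 0 < N -> 0 < n -> max_pdiv n <= z ->
    n * z ^ k <= N ^ k ->
  exists x : nat -> nat, n = \prod_(i < k) x i /\
    forall i, i < k -> [&& 0 < x i, x i <= N & max_pdiv (x i) <= z].
Proof.
move=> z0 N0; elim: k n => [|k IH] n n0 nz H.
  exists (fun=> 1); rewrite big_ord0; split=> //.
  by move: H; rewrite !expn0; lia.
have ex1 : exists d, (d %| n) && (d <= N) by exists 1; rewrite dvd1n.
have bnd d : (d %| n) && (d <= N) -> d <= N by case/andP.
case: (ex_maxnP ex1 bnd) => d /andP[dn dN] dmax.
have d0 := dvdn_gt0 n0 dn.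
have m0 : 0 < n %/ d by rewrite divn_gt0 // dvdn_leq.
have mz : max_pdiv (n %/ d) <= z by apply: max_pdiv_dvd_le nz => //; apply: dvdn_div.
have [|x [En Hx]] := IH (n %/ d) m0 mz.
  (* With quotient 1 no prime is left to compare with. The remaining condition [z ^ k <= N ^ k]
     follows from [z <= N], which the hypothesis on [n >= 1] forces. *)
  have [E|m1] := eqVneq (n %/ d) 1.
    rewrite E mul1n.
    case: k {IH} H => [//|k] H.
    have : z ^ k.+2 <= N ^ k.+2 by apply: leq_trans H; rewrite leq_pmull.
    by rewrite !leq_exp2r.
  have m2 : 1 < n %/ d by lia.
  pose p := max_pdiv (n %/ d).
  have pp : prime p by apply: max_pdiv_prime.
  have dpN : N < d * p.
    rewrite ltnNge; apply/negP => h.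
    have := dmax (d * p); rewrite h andbT -{1}(divnK dn) mulnC dvdn_pmul2r //.
    rewrite max_pdiv_dvd => /(_ isT); have := prime_gt1 pp; nia.
  have : N * (n %/ d * z ^ k) <= N * N ^ k.
    rewrite -expnS; apply: leq_trans H; rewrite expnS.
    apply: leq_trans (leq_mul (ltnW dpN) (leqnn _)) _.
    rewrite -{2}(divnK dn) [_ * d]mulnC -mulnA mulnCA [leqRHS]mulnCA.
    by rewrite -[d * _ * _]mulnA leq_mul2r [p <= z]mz orbT.
  by rewrite leq_pmul2l.
exists (fun i => if i is i'.+1 then x i' else d); split=> [|[_|i]].
- by rewrite big_ord_recl /= -En mulnC divnK.
- by rewrite d0 dN; apply: max_pdiv_dvd_le nz.
by rewrite ltnS; apply: Hx.
Qed.

(** * Chebyshev's upper bound for the number of primes *)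

Lemma prime_dvd_fact_leq p n : prime p -> p %| n`! -> p <= n.
Proof.
move=> pp; elim: n => [|n IH]; first by rewrite dvdn1 => /eqP p1; move: pp; rewrite p1.
rewrite factS Euclid_dvdM // => /orP[/dvdn_leq->//|/IH]; exact: leqW.
Qed.

Lemma prod_primes_dvd (s : seq nat) m : uniq s -> all prime s ->
  all (fun p => p %| m) s -> \prod_(p <- s) p %| m.
Proof.
elim: s => [|p s IH] /=; first by rewrite big_nil dvd1n.
move=> /andP[ps us] /andP[pp als] /andP[pm alm].
rewrite big_cons Gauss_dvd ?pm ?IH // prime_coprime //.
apply: contra ps; rewrite Euclid_dvd_prod // big_has => /hasP[q qs pq].
by move: pq; rewrite dvdn_prime2 ?(allP als q qs) // => /eqP->.
Qed.

(** The primes in [(n, 2n]] divide the numerator of the central binomial coefficient but not [n!],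
    so their product divides that coefficient, which is one term in the expansion of
    [(1 + 1) ^ n.*2]. *)
Lemma size_primes_upto_double n :
  n ^ (size (primes_upto n.*2) - size (primes_upto n)) <= 2 ^ n.*2.
Proof.
pose L := [seq p <- primes_upto n.*2 | n < p].
have -> : size (primes_upto n.*2) - size (primes_upto n) = size L.
  rewrite -(count_predC (leq^~ n)) -size_filter.
  have -> : size [seq p <- primes_upto n.*2 | p <= n] = size (primes_upto n).
    apply/perm_size/uniq_perm => [||p].
    - exact/filter_uniq/primes_upto_uniq.
    - exact: primes_upto_uniq.
    by rewrite mem_filter !mem_primes_upto; lia.
  rewrite addKn size_filter; apply: eq_count => p /=; lia.
have dv : \prod_(p <- L) p %| 'C(n.*2, n).
  have : all (fun p => p %| 'C(n.*2, n)) L.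
    apply/allP => p; rewrite mem_filter mem_primes_upto => /and3P[np pp pn].
    have : p %| (n.*2)`! by rewrite dvdn_fact // prime_gt0.
    rewrite -(@bin_fact n.*2 n); last by rewrite -addnn leq_addr.
    have pf : ~~ (p %| n`!).
      by apply/negP => /(prime_dvd_fact_leq pp); rewrite leqNgt np.
    by rewrite -addnn addnK !Euclid_dvdM // (negPf pf) !orbF.
  move=> h; apply: prod_primes_dvd h; first exact/filter_uniq/primes_upto_uniq.
  by apply/allP => p; rewrite mem_filter mem_primes_upto => /and3P[].
apply: leq_trans (_ : \prod_(p <- L) p <= _).
  rewrite -sum1_size expn_sum big_seq [leqRHS]big_seq.
  elim/big_ind2: _ => // [a b c d|p]; first exact: leq_mul.
  by rewrite mem_filter expn1 => /andP[/ltnW].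
apply: leq_trans (dvdn_leq _ dv) _.
  by rewrite bin_gt0 -addnn leq_addr.
rewrite -[2]/(1 + 1) expnDn; under eq_bigr do rewrite !exp1n !muln1.
have h : n < n.*2.+1 by lia.
by rewrite (bigD1 (Ordinal h)) //= leq_addr.
Qed.

Lemma size_primes_upto_pow2 e : e * size (primes_upto (2 ^ e)) <= 4 * 2 ^ e.
Proof.
elim: e => [//|e IH].
(* Doubling from [2 ^ m] to [2 ^ m.+1] gives at most [(m + 1) / m * (4 + 2) * 2 ^ m]. This is within
   [8 * 2 ^ m] exactly when [m >= 3], so smaller cases are computed. *)
case: e IH => [|[|[|e]]] IH; [by []|by []|by []|].
have := size_primes_upto_double (2 ^ e.+3); rewrite -expnM leq_exp2l //.
rewrite -mul2n -expnS => H.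
rewrite !expnS in H IH *; nia.
Qed.

Lemma size_primes_upto_log z : 0 < z ->
  (trunc_log 2 z).+1 * size (primes_upto z) <= 8 * z.
Proof.
move=> z0; set e := trunc_log 2 z.
have h1 := trunc_log_ltn z (isT : 1 < 2).
have h2 := trunc_logP (isT : 1 < 2) z0.
have := size_primes_upto_pow2 e.+1.
have h : size (primes_upto z) <= size (primes_upto (2 ^ e.+1)).
  apply: uniq_leq_size => [|p]; first exact: primes_upto_uniq.
  by rewrite !mem_primes_upto => /andP[-> /leq_trans->] //; apply: ltnW.
have : e.+1 * size (primes_upto z) <= e.+1 * size (primes_upto (2 ^ e.+1)).
  by rewrite leq_mul2l h orbT.
rewrite -/e !expnS in h2 *; lia.
Qed.

(** * The proportion of smooth integers missed *)

Lemma size_smooths_defect z N k : 1 < z -> 1 < N -> 0 < k ->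
  (size (smooths z (N ^ k)) - size (smooths z (N ^ k %/ z ^ k))) * trunc_log 2 N
    <= 16 * z * size (smooths z (N ^ k)).
Proof.
move=> z1 N1 k0; have z0 : 0 < z by lia.
(* Since [z < 2 ^ e], going down by [z ^ k] takes at most [e * k] halvings. *)
set e := (trunc_log 2 z).+1; set A := size (smooths z (N ^ k)).
set l := trunc_log 2 N.
have hA := size_smooths_div_pow2 (N ^ k) (e * k) z0.
have hl : 2 ^ (l * k) <= N ^ k by rewrite expnM leq_exp2r // trunc_logP //; lia.
have hO := mul_size_odd_smooths_le z1 hl.
have hC := size_primes_upto_log z0.
rewrite -/A -/e in hA hO hC.
have hB : size (smooths z (N ^ k %/ 2 ^ (e * k))) <= size (smooths z (N ^ k %/ z ^ k)).
  apply: uniq_leq_size => [|n]; first exact: smooths_uniq.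
  rewrite !mem_smooths => /and3P[-> h ->]; rewrite andbT /=.
  apply: leq_trans h _; apply: leq_div2l; rewrite ?expn_gt0 ?z0 //.
  by rewrite expnM leq_exp2r // ltnW // trunc_log_ltn.
set B := size (smooths z (N ^ k %/ z ^ k)) in hB *.
set O := size (odd_smooths _ _) in hA hO.
set r := size (primes_upto z) in hO hC.
have h3 : A - B <= e * k * O by lia.
(* The extra factor [k] makes [l * k * O] appear, so that [hO] applies; then [e * r <= 8 * z] yields
   the constant 16. Cancelling [k] leaves a bound uniform in [k]. *)
have : k * ((A - B) * l) <= k * (16 * z * A).
  apply: (@leq_trans (e * (l * k * O) * k)); first by nia.
  apply: (@leq_trans (e * (2 * r * A) * k)).
    by rewrite leq_mul2r leq_mul2l hO !orbT.
  by nia.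
by rewrite leq_pmul2l.
Qed.

(** * Passage to [M] and [Psi], and the limit *)

Local Open Scope classical_set_scope.
Local Open Scope ring_scope.

Lemma smooth_truncn (R : realType) (y : R) n : 0 <= y ->
  smooth y n = (max_pdiv n <= Num.truncn y)%N.
Proof. by move=> y0; rewrite /smooth truncn_ge_nat. Qed.

Lemma Psi_smooths (R : realType) (y : R) N k : 0 <= y ->
  Psi (N%:R ^+ k) y = size (smooths (Num.truncn y) (N ^ k)).
Proof.
move=> y0; rewrite /Psi -natrX natrK; set m := (N ^ k)%N.
pose P n := (0 < n)%N && (max_pdiv n <= Num.truncn y)%N.
transitivity (count P (iota 0 m.+1)).
  rewrite -val_enum_ord count_map enumT cardE /enum_mem size_filter.
  by apply: eq_count => n; rewrite /= unfold_in /= smooth_truncn.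
rewrite /P /= add0n /smooths size_filter; apply: eq_in_count => n.
by rewrite mem_iota => /andP[-> _].
Qed.

Lemma M_le_smooths (R : realType) (y : R) N k : 1 <= y ->
  (M k N y <= size (smooths (Num.truncn y) (N ^ k)))%N.
Proof.
move=> y1; have y0 : 0 <= y := le_trans ler01 y1.
have z0 : (0 < Num.truncn y)%N by rewrite truncn_gt0.
rewrite -(undup_id (smooths_uniq _ _)) -card_fseq; apply: fsubset_leq_card.
apply/fsubsetP => n /imfsetP[x /= /forallP H ->]; rewrite in_fset mem_smooths /=.
have Hx i : [&& (0 < x i)%N, (x i <= N)%N & (max_pdiv (x i) <= Num.truncn y)%N].
  by have /andP[-> h] := H i; rewrite -ltnS ltn_ord -smooth_truncn.
apply/and3P; split.
- by apply: prodn_gt0 => i; case/and3P: (Hx i).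
- rewrite -[k in leqRHS]card_ord -prod_nat_const.
  by apply: leq_prod => i _; case/and3P: (Hx i).
have : (0 < \prod_(i < k) x i)%N /\ (max_pdiv (\prod_(i < k) x i) <= Num.truncn y)%N.
  elim/big_ind: _ => [|a b [a0 az] [b0 bz]|i _]; first by [].
    by rewrite muln_gt0 a0 b0; split=> //; apply: max_pdiv_mul_le.
  by case/and3P: (Hx i).
by case.
Qed.

(** With [M_le_smooths], this places [M] between the two counts compared in
    [size_smooths_defect]. *)
Lemma smooths_le_M (R : realType) (y : R) N k : 1 <= y -> (0 < N)%N ->
  (size (smooths (Num.truncn y) (N ^ k %/ Num.truncn y ^ k)) <= M k N y)%N.
Proof.
move=> y1 N0; have y0 : 0 <= y := le_trans ler01 y1.
have z0 : (0 < Num.truncn y)%N by rewrite truncn_gt0.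
rewrite -(undup_id (smooths_uniq _ _)) -card_fseq; apply: fsubset_leq_card.
apply/fsubsetP => n; rewrite in_fset /= mem_smooths => /and3P[n0 nN nz].
rewrite leq_divRL ?expn_gt0 ?z0 // in nN.
have [x [-> Hx]] := smooth_factorization z0 N0 n0 nz nN.
have lt (i : 'I_k) : (x i < N.+1)%N by have /and3P[_ + _] := Hx i (ltn_ord i).
apply/imfsetP; exists [ffun i : 'I_k => Ordinal (lt i)] => /=.
  apply/forallP => i; rewrite ffunE /= smooth_truncn //.
  by have /and3P[-> _ ->] := Hx i (ltn_ord i).
by apply: eq_bigr => i _; rewrite ffunE.
Qed.

(** Combines [ln 2 <= 1] with [l.+1 <= 2 * l] for [l = trunc_log 2 N], where [l >= 1] because
    [N >= 2]. *)
Lemma ln_le_trunc_log (R : realType) N : (1 < N)%N ->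
  ln (N%:R : R) <= 2 * (trunc_log 2 N)%:R.
Proof.
move=> N1; have N0 : (0 < N)%N by apply: ltnW.
have l0 : (0 < trunc_log 2 N)%N by rewrite trunc_log_gt0.
have : ln (N%:R : R) <= ln ((2 : R) ^+ (trunc_log 2 N).+1).
  rewrite ler_ln ?posrE ?ltr0n ?exprn_gt0 // -natrX ler_nat ltnW //.
  exact: trunc_log_ltn.
move=> /le_trans; apply; rewrite lnXn // -[leLHS]mulr_natr.
have ln2 : ln (2 : R) <= 1.
  by apply: (@le_ln1Dx R 1); rewrite (@lt_trans _ _ 0) ?ltrN10.
apply: (@le_trans _ _ (1 * (trunc_log 2 N).+1%:R)); first by rewrite ler_wpM2r.
by rewrite mul1r -natrM ler_nat; lia.
Qed.

(** The 16 of [size_smooths_defect] doubles through [ln_le_trunc_log]. *)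
Lemma M_div_Psi_le (R : realType) (y : R) N k : 2 <= y -> (1 < N)%N -> (0 < k)%N ->
  `|(M k N y)%:R / (Psi (N%:R ^+ k) y)%:R - 1| <= 32 * (y / ln (N%:R : R)).
Proof.
move=> y2 N1 k0; have N0 : (0 < N)%N by apply: ltnW.
have y1 : 1 <= y by apply: le_trans y2; rewrite ler1n.
have y0 : 0 <= y := le_trans ler01 y1.
have z1 : (1 < Num.truncn y)%N by rewrite truncn_ge_nat.
rewrite Psi_smooths //; set A := size _.
have A0 : 0 < A%:R :> R.
  rewrite ltr0n lt0n size_eq0; apply/eqP => E.
  have : 1%N \in smooths (Num.truncn y) (N ^ k).
    by rewrite mem_smooths expn_gt0 N0 (ltnW z1).
  by rewrite E.
have MA : (M k N y <= A)%N by apply: M_le_smooths.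
have l0 : (0 < trunc_log 2 N)%N by rewrite trunc_log_gt0.
have lnN0 : 0 < ln (N%:R : R) by rewrite ln_gt0 // ltr1n.
have H : ((A - M k N y) * trunc_log 2 N <= 16 * Num.truncn y * A)%N.
  apply: leq_trans (size_smooths_defect z1 N1 k0); rewrite leq_mul2r leq_sub2l ?orbT //.
  exact: smooths_le_M.
have -> : (M k N y)%:R / A%:R - 1 = - ((A - M k N y)%:R / A%:R) :> R.
  by rewrite natrB // mulrBl divff ?lt0r_neq0 // opprB.
rewrite normrN ger0_norm ?divr_ge0 // ler_pdivrMr // mulrA mulrAC ler_pdivlMr //.
apply: le_trans (ler_wpM2l _ (ln_le_trunc_log R N1)) _ => //.
rewrite mulrCA -natrM.
apply: (@le_trans _ _ (2 * (16 * Num.truncn y * A)%:R)).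
  by rewrite ler_pM2l // ler_nat.
rewrite !natrM !mulrA -natrM ler_wpM2r // ler_wpM2l // truncn_le //.
Qed.

Theorem theorem1p1 (R : realType) (y : nat -> R)
    (y_ge2 : forall N : nat, (2 <= N)%N -> 2 <= y N)
    (y_littleo : y =o_\oo (fun N : nat => ln (N%:R : R))) :
  ereal_sup [set (`| (M k N (y N))%:R / (Psi (N%:R ^+ k) (y N))%:R - 1 |)%:E
            | k in [set k : nat | (1 <= k)%N]]
    @[N --> \oo] --> (0 : \bar R)%E.
Proof.
have ratio0 : 32 * (y N / ln (N%:R : R)) @[N --> \oo] --> (0 : R).
  apply/cvgr0Pnorm_le => e e0.
  have e32 : 0 < e / 32 by rewrite divr_gt0.
  have /eqoP/(_ _ e32) := y_littleo; apply: filterS2 (nbhs_infty_ge 2).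
  move=> N N2 h; have lnN0 : 0 < ln (N%:R : R) by rewrite ln_gt0 // ltr1n.
  rewrite !normrM normfV mulrA ler_pdivrMr ?normr_gt0 ?lt0r_neq0 //.
  by rewrite ger0_norm // mulrC -ler_pdivlMr // mulrAC.
apply: (@squeeze_cvge _ _ _ _ (fun=> 0%E) _
    (fun N => (32 * (y N / ln (N%:R : R)))%:E)).
- apply: filterS (nbhs_infty_ge 2) => N N2; apply/andP; split.
    (* The supremum of an empty set would be minus infinity, so nonnegativity needs a member;
       [k = 1] supplies one. *)
    apply: ereal_sup_ge; eexists; first by exists 1%N.
    by rewrite lee_fin.
  apply: ge_ereal_sup => _ [k /= k1 <-].
  by rewrite lee_fin M_div_Psi_le ?y_ge2.
- exact: cvg_cst.
by apply/fine_cvgP; split=> //; near=> x.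
Unshelve. all: by end_near. Qed.
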